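(* For each $\mathfrak{g}\in\mathfrak{G}$ there exists a unique algebraic vector field $\mathsf{R}_{\mathfrak{g}}$ on $\mathsf{T}$ such that $$\nabla_{\mathsf{R}_{\mathfrak{g}}}\begin{pmatrix}\alpha\\ \beta\end{pmatrix}=\mathfrak{g}^{T}\begin{pmatrix}\alpha\\ \beta\end{pmatrix}.$$
   Context: $\mathsf{T}=\operatorname{Spec}\left(\mathbb{C}[t_1,t_2,t_3,\frac{1}{27t_3^2-t_2^3}]\right)$ is the moduli space of enhanced elliptic curves, with coordinates $t_1,t_2,t_3$. For $t=(t_1,t_2,t_3)\in\mathsf{T}$ let $E_{t_2,t_3}$ be the elliptic curve with affine equation $y^2=4x^3-t_2x-t_3$. Its first de Rham cohomology has basis given by the classes $\frac{dx}{y},\frac{x\,dx}{y}$, and one sets $\begin{pmatrix}\alpha\\ \beta\end{pmatrix}=\begin{pmatrix}1&0\\ t_1&1\end{pmatrix}\begin{pmatrix}\frac{dx}{y}\\ \frac{x\,dx}{y}\end{pmatrix}$. Thus $\alpha,\beta$ are global sections of the relative de Rham cohomology bundle $H^1_{dR}$ over $\mathsf{T}$ of the universal family $(E_{t_2,t_3},\alpha,\beta)$, forming a frame. $\nabla$ denotes the Gauss–Manin connection on this bundle, applied entrywise to column vectors of sections. Let $\mathsf{G}=\{g\in\mathsf{Mat}_2(\mathbb{C})\mid g^TJg=J,\ g_{21}=0\}$ with $J=\begin{pmatrix}0&1\\-1&0\end{pmatrix}$, a complex algebraic group. $\mathfrak{G}$ (the AMSY Lie algebra) is the Lie subalgebra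 of $\mathfrak{gl}_2(\mathbb{C})$ generated by $\operatorname{Lie}(\mathsf{G})$ together with the transposes $x^T$ of all $x$ in the nilradical of $\operatorname{Lie}(\mathsf{G})$. *)

(* Defs.v *)
From HB Require Import structures.
From mathcomp Require Import all_boot all_order all_algebra.
From mathcomp Require Import qpoly.
From mathcomp Require Import boolp reals complex.
From mathcomp Require Import mpoly.
From mathcomp Require Import ring.

Set Implicit Arguments.
Unset Strict Implicit.
Unset Printing Implicit Defensive.

Import GRing.Theory.
Local Open Scope ring_scope.

(** * Kähler differentials and algebraic de Rham cohomology of a relative
      affine curve Spec A -> Spec k *)

Section KahlerDifferentials.

Variables (k A : comNzRingType) (i : {rmorphism k -> A}).

Definition derivation (M : lmodType A) (D : A -> M) : Prop :=
  [/\ forall a b, D (a + b) = D a + D b,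
      forall a b, D (a * b) = a *: D b + b *: D a
    & forall c, D (i c) = 0].

(* The list [:: (a_1, b_1); ...; (a_n, b_n)] stands for the differential form
   a_1 d b_1 + ... + a_n d b_n of Omega^1_{A/k}, and concatenation for the sum.
   By the universal property of Omega^1_{A/k}, two such sums are equal iff they
   have the same image under the A-linear map induced by each k-derivation. *)
Definition form := seq (A * A).

Definition form_eval (M : lmodType A) (D : A -> M) (w : form) : M :=
  \sum_(p <- w) p.1 *: D p.2.

Definition form_eq (w1 w2 : form) : Prop :=
  forall (M : lmodType A) (D : A -> M),
    derivation D -> form_eval D w1 = form_eval D w2.

Definition form_scale (a : A) (w : form) : form :=
  [seq (a * p.1, p.2) | p <- w].

Definition form_d (g : A) : form := [:: (1, g)].

(* Equality in H^1_dR(A/k) = Omega^1_{A/k} / dA; every form is closed because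
   the relative dimension is one. *)
Definition H1dR_eq (w1 w2 : form) : Prop :=
  exists g : A, form_eq w1 (w2 ++ form_d g).

(* L_X (a d b) = X(a) d b + a d(X(b)) *)
Definition lie_derivative (X : A -> A) (w : form) : form :=
  flatten [seq [:: (X p.1, p.2); (p.1, X p.2)] | p <- w].

End KahlerDifferentials.

Section GaussManin.

Variables (C k A : comNzRingType).
Variables (j : {rmorphism C -> k}) (i : {rmorphism k -> A}).

Definition vector_field (V : k -> k) : Prop := derivation j (V : k -> k^o).

Definition lifts (V : k -> k) (X : A -> A) : Prop :=
  derivation (i \o j) (X : A -> A^o) /\ forall c, X (i c) = i (V c).

(* gauss_manin V w1 w2 says that nabla_V [w1] = [w2] in H^1_dR(A/k): the
   Gauss-Manin connection is the Lie derivative along any lift X of V to the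
   total space.  Two lifts differ by a k-derivation Y, and
   L_Y w = d(iota_Y w) for relative 1-forms w on a curve, so that the class
   does not depend on X. *)
Definition gauss_manin (V : k -> k) (w1 w2 : form A) : Prop :=
  exists X : A -> A, lifts V X /\ H1dR_eq i (lie_derivative X w1) w2.

End GaussManin.

(** * The affine Weierstrass curve y^2 = 4 x^3 - a x - b over a base ring *)

Section WeierstrassCurve.

Variables (k : comNzRingType) (a b : k).

Definition weierstrass : {poly {poly k}} :=
  'X^2 - (4%:R *: 'X^3 - a *: 'X - b%:P)%:P.

(* The coordinate ring k[x][y] / (y^2 - (4 x^3 - a x - b)) of the curve
   deprived of its point O at infinity.  Removing O does not change H^1_dR of
   an elliptic curve (regular forms on the complement of O have no residue at O
   and are therefore of the second kind); x dx/y, which has a double pole at O,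
   has a class in H^1_dR in this sense. *)
Definition curve_ring := {poly %/ weierstrass}.

HB.instance Definition _ := GRing.ComNzRing.on curve_ring.

Definition curve_scalar : {rmorphism k -> curve_ring} :=
  in_qpoly weierstrass \o polyC \o polyC.

Definition curve_x : curve_ring := in_qpoly weierstrass 'X%:P.
Definition curve_y : curve_ring := in_qpoly weierstrass 'X.

Lemma curve_eq :
  curve_y ^+ 2 =
  4%:R * curve_x ^+ 3 - curve_scalar a * curve_x - curve_scalar b.
Proof.
set f := 4%:R *: 'X^3 - a *: 'X - b%:P.
have wE : weierstrass = 'X^2 - f%:P by [].
have size_w : size weierstrass = 3.
  rewrite wE size_polyDl ?size_polyXn // size_polyN.
  by rewrite (leq_ltn_trans (size_polyC_leq1 _)).
have monic_w : weierstrass \is monic.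
  rewrite monicE lead_coefE size_w wE coefB coefXn coefC /=.
  by rewrite subr0.
have w0 : in_qpoly weierstrass weierstrass = 0.
  apply: val_inj => /=; rewrite /mk_monic size_w monic_w /=.
  exact: Pdiv.RingMonic.rmodpp.
have inB p q : in_qpoly weierstrass (p - q) =
    in_qpoly weierstrass p - in_qpoly weierstrass q by exact: rmorphB.
have inX p n : in_qpoly weierstrass (p ^+ n) = in_qpoly weierstrass p ^+ n.
  elim: n => [|n IHn]; first exact: in_qpoly1.
  by rewrite !exprS in_qpolyM IHn.
apply/eqP; rewrite -subr_eq0; apply/eqP; rewrite -[RHS]w0.
transitivity (in_qpoly weierstrass ('X^2 - f%:P)); last by [].
rewrite inB inX; congr (_ - _).
rewrite /f !polyCB !inB -!mul_polyC (polyCM _ 'X) (polyCM _ 'X^3) !in_qpolyM.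
rewrite polyC_exp inX.
have sE c : curve_scalar c = in_qpoly weierstrass c%:P%:P by [].
have E4 : in_qpoly weierstrass (4%:R : {poly k})%:P = 4%:R.
  by rewrite polyC_natr; apply: rmorph_nat.
by rewrite !sE (polyC_natr _ 4) E4.
Qed.

(* d is the inverse of 27 b^2 - a^3.  With f = 4 x^3 - a x - b there is then a
   Bezout identity p f + q f' = 1, so that dx/y is the regular form
   p y dx + 2 q dy, because y^2 = f and 2 y dy = f' dx; see dx_over_yP. *)
Definition dx_over_y (d : k) : form curve_ring :=
  let s := curve_scalar in
  let x := curve_x in
  let p := s d * (18%:R * s a * x - 27%:R * s b) in
  let q := s d * (s a ^+ 2 - 6%:R * s a * x ^+ 2 + 9%:R * s b * x) in
  [:: (p * curve_y, x); (2%:R * q, curve_y)].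

Lemma dx_over_yP (d : k) :
  d * (27%:R * b ^+ 2 - a ^+ 3) = 1 ->
  form_eq curve_scalar (form_scale curve_y (dx_over_y d)) [:: (1, curve_x)].
Proof.
move=> dP M D [DD DM Dk]; rewrite /dx_over_y; cbv zeta.
have sP : curve_scalar d *
    (27%:R * curve_scalar b ^+ 2 - curve_scalar a ^+ 3) = 1.
  by rewrite -!(rmorphXn curve_scalar) -(rmorph_nat curve_scalar 27) -rmorphM
             -rmorphB -rmorphM dP rmorph1.
have D4 u : D (4%:R * u) = 4%:R *: D u.
  by rewrite DM -(rmorph_nat curve_scalar) Dk scaler0 addr0.
have DN u : D (- u) = - D u.
  by apply/eqP; rewrite -addr_eq0 -DD addNr -(rmorph0 curve_scalar) Dk.
have W := curve_eq; have := congr1 D W.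
have := Dk a; have := Dk b.
move: (curve_scalar d) (curve_scalar a) (curve_scalar b) sP W.
move: curve_x curve_y => x y d' a' b' sP W Db Da DW.
have Dy : (2%:R * y) *: D y = (12%:R * x ^+ 2 - a') *: D x.
  move: DW; rewrite !DD !DN D4 !DM Da Db scaler0 oppr0 !addr0.
  rewrite !scalerDr !scalerA -!scalerDl -scaleNr -scalerDl => E.
  transitivity ((y + y) *: D y); first by congr (_ *: _); ring.
  by rewrite E; congr (_ *: _); ring.
rewrite /form_eval /= !big_cons big_nil /=.
set q := d' * (_ - _ + _); set p := d' * (_ - _).
have -> : y * (2%:R * q) = q * (2%:R * y) by ring.
rewrite -(scalerA q) Dy scalerA !addr0 -scalerDl; congr (_ *: _).
have -> : y * (p * y) = p * y ^+ 2 by ring.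
by rewrite W -[RHS]sP /p /q; ring.
Qed.

End WeierstrassCurve.

(** * The moduli space T and the universal family *)

Section ModuliSpace.

Variable R : realType.

Local Notation C := R[i].
Local Notation FT := {fraction {mpoly C[3]}}.

Definition discr : {mpoly C[3]} :=
  27%:R *: 'X_(inord 2) ^+ 2 - 'X_(inord 1) ^+ 3.

(* O(T) = C[t1, t2, t3, 1 / (27 t3^2 - t2^3)], inside C(t1, t2, t3) *)
Definition regular_pred : pred FT :=
  fun f => `[< exists (p : {mpoly C[3]}) (n : nat),
                 f = tofrac p / tofrac discr ^+ n >].

Lemma discr_neq0 : discr != 0.
Proof.
apply/eqP => /(congr1 (mcoeff (U_(inord 2) *+ 2))%R).
rewrite mcoeff0 mcoeffB mcoeffZ !mpolyXn !mcoeffX eqxx.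
have /negbTE-> : (U_(inord 1) *+ 3 != U_(inord 2) *+ 2 :> 'X_{1..3})%MM.
  apply/eqP => /(congr1 mdeg); by rewrite !mdegMn !mdeg1.
by rewrite subr0 mulr1 => /eqP; rewrite Num.Theory.pnatr_eq0.
Qed.

Lemma regular_subring : subring_closed regular_pred.
Proof.
have nz n : tofrac discr ^+ n != 0 :> FT.
  by rewrite expf_neq0 // tofrac_eq0 discr_neq0.
split.
- by apply/asboolP; exists 1, 0%N; rewrite rmorph1 expr0 divr1.
- move=> f g /asboolP[p [n ->]] /asboolP[q [m ->]]; apply/asboolP.
  exists (p * discr ^+ m - q * discr ^+ n), (n + m)%N.
  rewrite (tofracB (p * _)) (tofracM p) (tofracM q) !tofracXn exprD.
  by rewrite -mulNr addf_div // mulNr.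
- move=> f g /asboolP[p [n ->]] /asboolP[q [m ->]]; apply/asboolP.
  by exists (p * q), (n + m)%N; rewrite mulf_div (tofracM p) exprD.
Qed.

HB.instance Definition _ :=
  GRing.isSubringClosed.Build FT regular_pred regular_subring.

Definition OT := {f : FT | regular_pred f}.

HB.instance Definition _ := [isSub of OT for @sval _ _].
HB.instance Definition _ := [Choice of OT by <:].
HB.instance Definition _ := [SubChoice_isSubComNzRing of OT by <:].

Lemma regular_poly (p : {mpoly C[3]}) : regular_pred (tofrac p).
Proof. by apply/asboolP; exists p, 0%N; rewrite expr0 divr1. Qed.

Lemma regular_inv_discr : regular_pred (tofrac discr)^-1.
Proof. by apply/asboolP; exists 1, 1%N; rewrite rmorph1 expr1 mul1r. Qed.

Definition OT_poly (p : {mpoly C[3]}) : OT := Sub (tofrac p) (regular_poly p).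

Lemma OT_poly_additive : additive OT_poly.
Proof. by move=> p q; apply: val_inj; rewrite /= rmorphB. Qed.

Lemma OT_poly_multiplicative : monoid_morphism OT_poly.
Proof.
by split=> [|p q]; apply: val_inj; rewrite /= ?rmorph1 ?rmorphM.
Qed.

HB.instance Definition _ :=
  GRing.isZmodMorphism.Build {mpoly C[3]} OT OT_poly OT_poly_additive.
HB.instance Definition _ :=
  GRing.isMonoidMorphism.Build {mpoly C[3]} OT OT_poly OT_poly_multiplicative.

Definition OT_const : {rmorphism C -> OT} := OT_poly \o @mpolyC 3 C.

Definition t1 : OT := OT_poly 'X_(inord 0).
Definition t2 : OT := OT_poly 'X_(inord 1).
Definition t3 : OT := OT_poly 'X_(inord 2).
Definition inv_discr : OT := Sub (tofrac discr)^-1 regular_inv_discr.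

Lemma inv_discrE : inv_discr * (27%:R * t3 ^+ 2 - t2 ^+ 3) = 1.
Proof.
have -> : 27%:R * t3 ^+ 2 - t2 ^+ 3 = OT_poly discr.
  rewrite /discr (rmorphB OT_poly) (rmorphXn OT_poly) -mulr_algl scaler_nat.
  by rewrite (rmorphM OT_poly) (rmorph_nat OT_poly) (rmorphXn OT_poly).
by apply: val_inj; rewrite /= mulVf // tofrac_eq0 discr_neq0.
Qed.

(* Functions on the universal elliptic curve over T minus its zero section *)
Definition OE := curve_ring t2 t3.
Definition OE_scalar : {rmorphism OT -> OE} := curve_scalar t2 t3.

Definition alpha : form OE := dx_over_y t2 t3 inv_discr.

Definition beta : form OE :=
  form_scale (OE_scalar t1) alpha ++ form_scale (curve_x t2 t3) alpha.

Definition frame (i : 'I_2) : form OE := if i == 0 then alpha else beta.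

(* The i-th entry of M (alpha, beta)^T for a constant matrix M *)
Definition mx_frame (M : 'M[C]_2) (i : 'I_2) : form OE :=
  flatten [seq form_scale (OE_scalar (OT_const (M i j))) (frame j)
          | j <- enum 'I_2].

End ModuliSpace.

(** * The AMSY Lie algebra *)

Section LieAlgebra.

Variables (F : fieldType) (n : nat).
Local Notation gl := 'M[F]_n.

Definition lie_bracket (x y : gl) : gl := x *m y - y *m x.

Definition lie_subalgebra (V : {vspace gl}) : Prop :=
  forall x y, x \in V -> y \in V -> lie_bracket x y \in V.

Definition lie_generated (S : gl -> Prop) (x : gl) : Prop :=
  forall V : {vspace gl},
    lie_subalgebra V -> (forall y, S y -> y \in V) -> x \in V.

Definition lie_ideal (g : gl -> Prop) (I : {vspace gl}) : Prop :=
  (forall x, x \in I -> g x) /\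
  forall x y, g x -> y \in I -> lie_bracket x y \in I.

Definition lie_product (U V : {vspace gl}) : {vspace gl} :=
  <<[seq lie_bracket u v | u <- vbasis U, v <- vbasis V]>>%VS.

Definition lie_nilpotent (I : {vspace gl}) : Prop :=
  exists m, iter m (lie_product I) I = 0%VS.

(* The nilradical is the largest nilpotent ideal; since sums of nilpotent
   ideals are nilpotent ideals, it is the union of all of them. *)
Definition nilradical (g : gl -> Prop) (x : gl) : Prop :=
  exists I, [/\ lie_ideal g I, lie_nilpotent I & x \in I].

End LieAlgebra.

Definition symplectic_J (K : comNzRingType) : 'M[K]_2 :=
  delta_mx 0 1 - delta_mx 1 0.

(* The K-points of the algebraic group G *)
Definition group_G (K : comNzRingType) (g : 'M[K]_2) : Prop :=
  g^T *m symplectic_J K *m g = symplectic_J K /\ g 1 0 = 0.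

(* The tangent space at 1: matrices x with 1 + eps x in G(F[eps]/(eps^2)) *)
Definition Lie_G (F : fieldType) (x : 'M[F]_2) : Prop :=
  group_G (1%:M + \matrix_(i, j) in_qpoly 'X^2 (x i j *: 'X)).

Definition amsy (F : fieldType) : 'M[F]_2 -> Prop :=
  lie_generated (fun x =>
    Lie_G x \/ exists2 y, nilradical (@Lie_G F) y & x = y^T).

(* Main.v *)
Require Import Defs.
From HB Require Import structures.
From mathcomp Require Import all_boot all_order all_algebra.
From mathcomp Require Import qpoly.
From mathcomp Require Import boolp reals complex.
From mathcomp Require Import mpoly.
From mathcomp Require Import ring.

Set Implicit Arguments.
Unset Strict Implicit.
Unset Printing Implicit Defensive.

Import GRing.Theory.
Local Open Scope ring_scope.

(** Write Omega^1 for the differentials of the universal curve minus its zero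
    section, relative to T, with coordinate ring A = O(T)[x, y] / (y^2 - P),
    P = 4 x^3 - t2 x - t3, and P' = dP/dx.

    The class of dx/y generates Omega^1 freely: the derivation H with H(x) = y
    and H(y) = P'/2 takes the value 1 on dx/y, and D(f) = H(f) D(dx/y) for
    every relative derivation D ([derivation_curve_eq]).  Sending a form to its
    coefficient against dx/y thus identifies H^1_dR with A / H(A)
    ([H1dR_eq_coeff]), and the frame alpha, beta with 1, t1 + x.  A Lie
    derivative becomes f |-> X(f) + c f, where [H, X] = c H
    ([coeff_lie_derivative]); two lifts of a vector field differ by some e H,
    which changes the result by the exact term H(e f)
    ([coeff_lie_vertical]).

    A vector field V on T is given by V(t1) and by the functions B, D with
      (V(t2), V(t3)) = B (4 t2, 6 t3) + D (72 t3, 4 t2^2),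
    the determinant of this system being -16 (27 t3^2 - t2^3), a unit
    ([field_coordinates]).  The first vector is the weighted Euler field, and
    the second one is -12 times the part free of t1 in the components
    4 t1 t2 - 6 t3, 6 t1 t3 - t2^2 / 3 of Ramanujan's field; both lift to the
    curve by polynomials in x and y, with c = 12 D x - B.  As
    H(y) = 6 x^2 - t2/2, the Gauss-Manin matrix of V is
      nabla alpha = (- B - 12 D t1) alpha + 12 D beta,
      nabla beta  = (V(t1) - D t2 - 2 B t1 - 12 D t1^2) alpha
                    + (B + 12 D t1) beta
    ([gauss_manin_alpha], [gauss_manin_beta]).  These coefficients are well
    defined because 1 and x are independent modulo H(A)
    ([cohomology_free]): an element g0(x) + g1(x) y with g1 of degree n and
    leading coefficient l is sent by H to something whose part without y has
    leading term (4 n + 6) l x^(n+2).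

    The matrix is traceless and runs through all traceless matrices, each one
    determining B, D and V(t1).  Since the Lie algebra of G, hence its
    nilradical, is contained in sl_2, so is the algebra that they generate with
    transposes ([amsy_trace]), and the theorem follows. *)

(** * Derivations along a ring morphism *)

(** With phi the identity this is a derivation of a ring over the integers, so
    that a derivation lifting a vector field, which is not linear over the
    base, is covered; general phi is what quotients and localizations need. *)
Definition derivation_along (B E : comNzRingType) (phi : B -> E)
    (D : B -> E) : Prop :=
  (forall a b, D (a + b) = D a + D b) /\
  (forall a b, D (a * b) = phi a * D b + phi b * D a).

Section DerivationAlong.

Variables (B E : comNzRingType) (phi : {rmorphism B -> E}) (D : B -> E).
Hypothesis DP : derivation_along phi D.

Lemma along0 : D 0 = 0.
Proof. by apply: (@addrI _ (D 0)); rewrite -(proj1 DP) !addr0. Qed.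

Lemma alongN a : D (- a) = - D a.
Proof. by apply/eqP; rewrite -addr_eq0 -(proj1 DP) addNr along0. Qed.

Lemma along1 : D 1 = 0.
Proof.
apply: (@addrI _ (D 1)).
by rewrite addr0 -[in RHS](mulr1 1) (proj2 DP) rmorph1 mul1r.
Qed.

Lemma along_nat n : D n%:R = 0.
Proof.
elim: n => [|n IHn]; first exact: along0.
by rewrite -addn1 natrD (proj1 DP) IHn along1 addr0.
Qed.

Lemma along_natM n a : D (n%:R * a) = n%:R * D a.
Proof. by rewrite (proj2 DP) along_nat mulr0 addr0 rmorph_nat. Qed.

Lemma along_sum (I : Type) (r : seq I) (P : pred I) (F : I -> B) :
  D (\sum_(i <- r | P i) F i) = \sum_(i <- r | P i) D (F i).
Proof. by apply: (big_morph D (proj1 DP)); exact: along0. Qed.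

End DerivationAlong.

Section PolyDerivation.

Variables (B E : comNzRingType) (phi : {rmorphism {poly B} -> E}).
Variables (delta : B -> E) (e : E).
Hypothesis deltaP : derivation_along (phi \o polyC) delta.

(** The unique derivation along phi that is delta on constants and e on the
    variable: d(sum p_i X^i) = sum delta(p_i) phi(X)^i + phi(p') e. *)
Definition poly_derivation (p : {poly B}) : E :=
  (map_poly delta p).[phi 'X] + e * phi p^`().

Lemma horner_map_phi p : (map_poly (phi \o polyC) p).[phi 'X] = phi p.
Proof.
rewrite -[in RHS](coefK p) horner_poly poly_def rmorph_sum /=.
apply: eq_bigr => i _.
by rewrite -mul_polyC rmorphM rmorphXn.
Qed.

Lemma poly_derivationP : derivation_along phi poly_derivation.
Proof.
have d0 := along0 deltaP.
split=> p q; rewrite /poly_derivation.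
  have -> : map_poly delta (p + q) = map_poly delta p + map_poly delta q.
    by apply/polyP => i; rewrite coefD !coef_map_id0 // coefD (proj1 deltaP).
  by rewrite hornerD derivD rmorphD mulrDr addrACA.
have -> : map_poly delta (p * q) =
    map_poly (phi \o polyC) p * map_poly delta q
  + map_poly (phi \o polyC) q * map_poly delta p.
  apply/polyP => i.
  rewrite coefD coef_map_id0 // [(p * q)`_i]coefM (along_sum deltaP).
  rewrite (mulrC (map_poly _ q)) !coefM -big_split /=; apply: eq_bigr => j _.
  rewrite (proj2 deltaP) !coef_map_id0 ?rmorph0 //=.
  by rewrite [X in _ + X]mulrC.
rewrite hornerD !hornerM !horner_map_phi derivM rmorphD !rmorphM.
ring.
Qed.

Lemma poly_derivationC c : poly_derivation c%:P = delta c.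
Proof.
have d0 := along0 deltaP.
rewrite /poly_derivation derivC rmorph0 mulr0 addr0.
have -> : map_poly delta c%:P = (delta c)%:P; last exact: hornerC.
by apply/polyP => i; rewrite coef_map_id0 // !coefC; case: eqP.
Qed.

Lemma poly_derivationX : poly_derivation 'X = e.
Proof.
rewrite /poly_derivation derivX rmorph1 mulr1.
have -> : map_poly delta 'X = 0.
  apply/polyP => i; rewrite coef_map_id0 ?(along0 deltaP) // coefX coef0.
  by rewrite (along_nat deltaP (i == 1%N)).
by rewrite horner0 add0r.
Qed.

End PolyDerivation.

(** * Derivations of the coordinate ring of the curve *)

Section CurveRing.

Variables (k : comNzRingType) (a b : k).

Local Notation w := (weierstrass a b).
Local Notation A := (curve_ring a b).
Local Notation s := (curve_scalar a b).
Local Notation x := (curve_x a b).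
Local Notation y := (curve_y a b).

Lemma size_weierstrass : size w = 3.
Proof.
rewrite /weierstrass; set f := (X in X%:P).
rewrite size_polyDl ?size_polyXn // size_polyN.
by rewrite (leq_ltn_trans (size_polyC_leq1 _)).
Qed.

Lemma weierstrass_monic : w \is monic.
Proof.
rewrite monicE lead_coefE size_weierstrass coefB coefXn coefC /=.
by rewrite subr0.
Qed.

Lemma mk_monic_weierstrass : mk_monic w = w.
Proof. by rewrite /mk_monic size_weierstrass weierstrass_monic. Qed.

Definition curve_map : {rmorphism {poly {poly k}} -> A} := in_qpoly w.

Lemma curve_map_val (f : A) : curve_map (val f) = f.
Proof.
apply: val_inj => /=; apply: in_qpoly_small.
exact: size_mk_monic.
Qed.

Lemma val_curve_map (p : {poly {poly k}}) :
  exists q, p = q * w + val (curve_map p).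
Proof.
exists (Pdiv.Ring.rdivp p w) => /=; rewrite mk_monic_weierstrass.
exact: Pdiv.RingMonic.rdivp_eq weierstrass_monic p.
Qed.

Lemma curve_map_weierstrass : curve_map w = 0.
Proof.
apply: val_inj => /=; rewrite mk_monic_weierstrass.
exact: Pdiv.RingMonic.rmodpp weierstrass_monic.
Qed.

Lemma derivation_curve_ext (M : lmodType A) (D1 D2 : A -> M) :
  derivation s D1 -> derivation s D2 ->
  D1 x = D2 x -> D1 y = D2 y -> D1 =1 D2.
Proof.
move=> [D1D D1M D1s] [D2D D2M D2s] Ex Ey f; rewrite -(curve_map_val f).
elim/poly_ind: (val f : {poly {poly k}}) => [|p c IHp].
  have -> : curve_map 0 = s 0 by rewrite !rmorph0.
  by rewrite D1s D2s.
have Ec : D1 (curve_map c%:P) = D2 (curve_map c%:P).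
  elim/poly_ind: c => [|q c IHq].
    have -> : curve_map 0%:P = s 0 by rewrite !rmorph0.
    by rewrite D1s D2s.
  rewrite polyCD polyCM !rmorphD !rmorphM D1D D2D D1M D2M IHq.
  have -> : curve_map 'X%:P = x by [].
  have -> : curve_map c%:P%:P = s c by [].
  by rewrite Ex D1s D2s.
rewrite !rmorphD !rmorphM D1D D2D D1M D2M IHp.
have -> : curve_map 'X = y by [].
by rewrite Ey Ec.
Qed.

Section Lift.

Variables (V : k -> k) (xx yy : A).
Hypothesis VP : derivation_along idfun V.
Hypothesis tangent :
  2%:R * y * yy = (12%:R * x ^+ 2 - s a) * xx - s (V a) * x - s (V b).

Definition lift_poly : {poly {poly k}} -> A :=
  poly_derivation curve_map
    (poly_derivation (curve_map \o polyC) (s \o V) xx) yy.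

(** The derivation of the curve above the derivation V of the base that sends
    x to xx and y to yy; it exists as soon as (xx, yy) is tangent to the
    deformed equation y^2 = 4 x^3 - a x - b.  It is computed on the
    representative of degree at most one in y. *)
Definition curve_lift (f : A) : A := lift_poly (val f).

Lemma scalar_along : derivation_along ((curve_map \o polyC) \o polyC) (s \o V).
Proof.
split=> u v.
  by change (s (V (u + v)) = s (V u) + s (V v)); rewrite (proj1 VP) rmorphD.
change (s (V (u * v)) = s u * s (V v) + s v * s (V u)).
by rewrite (proj2 VP) rmorphD !rmorphM.
Qed.

Lemma lift_polyP : derivation_along curve_map lift_poly.
Proof. exact/poly_derivationP/poly_derivationP/scalar_along. Qed.

Lemma lift_polyC c : lift_poly c%:P%:P = s (V c).
Proof.
rewrite /lift_poly poly_derivationC; last first.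
  exact/poly_derivationP/scalar_along.
by rewrite poly_derivationC //; exact: scalar_along.
Qed.

Lemma lift_polyXC : lift_poly 'X%:P = xx.
Proof.
rewrite /lift_poly poly_derivationC; last first.
  exact/poly_derivationP/scalar_along.
by rewrite poly_derivationX //; exact: scalar_along.
Qed.

Lemma lift_polyX : lift_poly 'X = yy.
Proof.
by rewrite /lift_poly poly_derivationX //; exact/poly_derivationP/scalar_along.
Qed.

Lemma lift_poly_weierstrass : lift_poly w = 0.
Proof.
have LP := lift_polyP; have [LD LM] := LP.
have LN := alongN LP; have Ln := along_natM LP.
have -> : w = 'X * 'X -
    (4%:R * ('X%:P * ('X%:P * 'X%:P)) - a%:P%:P * 'X%:P - b%:P%:P).
  rewrite /weierstrass expr2; congr (_ - _).
  rewrite -!mul_polyC !polyC_natr !exprS expr0 mulr1 !polyCB !polyCM.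
  by rewrite polyC_natr.
rewrite !(LD, LN, Ln, LM, lift_polyC, lift_polyXC, lift_polyX).
have -> : curve_map 'X = y by [].
have -> : curve_map 'X%:P = x by [].
have -> : curve_map a%:P%:P = s a by [].
have -> : curve_map ('X%:P * 'X%:P) = x * x by rewrite rmorphM.
have -> : y * yy + y * yy = 2%:R * y * yy by ring.
rewrite tangent; ring.
Qed.

Lemma curve_lift_map p : curve_lift (curve_map p) = lift_poly p.
Proof.
have [q Ep] := val_curve_map p; rewrite [in RHS]Ep.
have [LD LM] := lift_polyP.
rewrite LD LM lift_poly_weierstrass curve_map_weierstrass.
by rewrite mulr0 mul0r !add0r.
Qed.

Lemma curve_lift_along : derivation_along idfun curve_lift.
Proof.
have [LD LM] := lift_polyP.
split=> f g; rewrite -(curve_map_val f) -(curve_map_val g).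
  by rewrite -rmorphD !curve_lift_map LD.
by rewrite -rmorphM !curve_lift_map LM.
Qed.

Lemma curve_lift_scalar c : curve_lift (s c) = s (V c).
Proof. by rewrite [LHS]curve_lift_map lift_polyC. Qed.

Lemma curve_lift_x : curve_lift x = xx.
Proof. by rewrite [LHS]curve_lift_map lift_polyXC. Qed.

Lemma curve_lift_y : curve_lift y = yy.
Proof. by rewrite [LHS]curve_lift_map lift_polyX. Qed.

End Lift.

End CurveRing.

(** * De Rham cohomology of the curve *)

Section Cohomology.

Variables (k : comNzRingType) (a b d half : k).
Hypothesis dP : d * (27%:R * b ^+ 2 - a ^+ 3) = 1.
Hypothesis halfP : 2%:R * half = 1.

Local Notation A := (curve_ring a b).
Local Notation s := (curve_scalar a b).
Local Notation x := (curve_x a b).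
Local Notation y := (curve_y a b).
Local Notation alpha := (dx_over_y a b d).

Lemma derivation_tangent (M : lmodType A) (D : A -> M) : derivation s D ->
  (2%:R * y) *: D y = (12%:R * x ^+ 2 - s a) *: D x.
Proof.
move=> [DD DM Ds].
have D4 u : D (4%:R * u) = 4%:R *: D u.
  by rewrite DM -(rmorph_nat s) Ds scaler0 addr0.
have DN u : D (- u) = - D u.
  by apply/eqP; rewrite -addr_eq0 -DD addNr -(rmorph0 s) Ds.
have := congr1 D (curve_eq a b); have := Ds a; have := Ds b.
move: (s a) (s b) x y => a' b' x' y' Db Da.
rewrite !DD !DN D4 !DM Da Db scaler0 oppr0 !addr0.
rewrite !scalerDr !scalerA -!scalerDl -scaleNr -scalerDl => E.
transitivity ((y' + y') *: D y'); first by congr (_ *: _); ring.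
by rewrite E; congr (_ *: _); ring.
Qed.

Lemma scalar_halfP : 2%:R * s half = 1.
Proof. by rewrite -(rmorph_nat s) -rmorphM halfP rmorph1. Qed.

Lemma zero_along (B : comNzRingType) : derivation_along (@idfun B) (fun=> 0).
Proof. by split=> u v; rewrite ?addr0 ?mulr0 ?addr0. Qed.

(** The vector field H dual to dx/y, that is, the Hamiltonian field of
    (y^2 - P) / 2: it sends x to y and y to P'/2. *)
Definition ham : A -> A :=
  curve_lift (fun=> 0) y (s half * (12%:R * x ^+ 2 - s a)).

Lemma ham_tangent : 2%:R * y * (s half * (12%:R * x ^+ 2 - s a)) =
  (12%:R * x ^+ 2 - s a) * y - s 0 * x - s 0.
Proof.
have := scalar_halfP.
rewrite rmorph0; move: (s half) (s a) x y => h' a' x' y' E.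
transitivity ((2%:R * h') * ((12%:R * x' ^+ 2 - a') * y')); first by ring.
by rewrite E; ring.
Qed.

Lemma ham_along : derivation_along idfun ham.
Proof. exact: curve_lift_along (@zero_along k) ham_tangent. Qed.

Lemma ham_scalar c : ham (s c) = 0.
Proof.
by rewrite [LHS](curve_lift_scalar (@zero_along k) ham_tangent) rmorph0.
Qed.

Lemma ham_x : ham x = y.
Proof. exact: curve_lift_x (@zero_along k) ham_tangent. Qed.

Lemma ham_y : ham y = s half * (12%:R * x ^+ 2 - s a).
Proof. exact: curve_lift_y (@zero_along k) ham_tangent. Qed.

Lemma ham_derivation : derivation s (ham : A -> A^o).
Proof.
by have [hD hM] := ham_along; split; [exact: hD|exact: hM|exact: ham_scalar].
Qed.

Lemma form_eval_alpha (M : lmodType A) (D : A -> M) : form_eval D alpha =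
  (s d * (18%:R * s a * x - 27%:R * s b) * y) *: D x
  + (2%:R * (s d * (s a ^+ 2 - 6%:R * s a * x ^+ 2 + 9%:R * s b * x))) *: D y.
Proof. by rewrite /form_eval !big_cons big_nil addr0. Qed.

Lemma scalar_discr : s d * (27%:R * s b ^+ 2 - s a ^+ 3) = 1.
Proof.
rewrite -!(rmorphXn s) -(rmorph_nat s 27) -rmorphM -rmorphB -rmorphM dP.
exact: rmorph1.
Qed.

(** The freeness of Omega^1 on dx/y.  Both sides are relative derivations, and
    they agree on x and y because y (dx/y) = dx and P'/2 (dx/y) = dy; the
    second relation uses the Bezout identity p P + q P' = 1 behind the
    definition of dx/y. *)
Lemma derivation_curve_eq (M : lmodType A) (D : A -> M) : derivation s D ->
  forall f, D f = ham f *: form_eval D alpha.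
Proof.
move=> DP; have [DD DM Ds] := DP; have [hD hM] := ham_along.
have EX : y *: form_eval D alpha = D x.
  have := dx_over_yP dP DP; rewrite /form_eval big_seq1 scale1r => <-.
  rewrite big_map scaler_sumr.
  by apply: eq_bigr => p _; rewrite scalerA.
apply: derivation_curve_ext => //.
- split=> [u v|u v|c]; first by rewrite hD scalerDl.
    by rewrite hM scalerDl !scalerA.
  by rewrite ham_scalar scale0r.
- by rewrite ham_x.
rewrite ham_y; have := derivation_tangent DP.
rewrite form_eval_alpha; have := curve_eq a b.
move: (s half) (s d) (s a) (s b) scalar_discr scalar_halfP.
move: (D x) (D y); move: x y => x' y' Dx Dy h' d' a' b' sP hP yE tE.
rewrite scalerDr !scalerA.
set p := d' * (_ - _); set q := d' * (_ - _ + _).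
set P' := 12%:R * _ - _ in tE *.
have -> : h' * P' * (p * y') = (h' * p * y') * P' by ring.
rewrite -[(_ * P') *: Dx]scalerA -tE scalerA -scalerDl -[LHS]scale1r.
congr (_ *: _).
have -> : h' * p * y' * (2%:R * y') + h' * P' * (2%:R * q)
        = 2%:R * h' * (p * y' ^+ 2 + q * P') by ring.
by rewrite hP yE mul1r -[LHS]sP /p /q /P'; ring.
Qed.

Lemma ham_alpha : form_eval (ham : A -> A^o) alpha = 1.
Proof.
rewrite form_eval_alpha ham_x ham_y; have := curve_eq a b.
move: (s half) (s d) (s a) (s b) scalar_discr scalar_halfP.
move: x y => x' y' h' d' a' b' sP hP yE.
rewrite /GRing.scale /=.
set p := d' * (_ - _); set q := d' * (_ - _ + _).
set P' := 12%:R * _ - _.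
have -> : p * y' * y' + 2%:R * q * (h' * P')
        = p * y' ^+ 2 + 2%:R * h' * (q * P') by ring.
by rewrite hP yE mul1r -[RHS]sP /p /q /P'; ring.
Qed.

(** By the freeness above, w is the multiple of dx/y by this function. *)
Definition coeff (w : Defs.form A) : A := form_eval (ham : A -> A^o) w.

Lemma form_eval_coeff (M : lmodType A) (D : A -> M) w : derivation s D ->
  form_eval D w = coeff w *: form_eval D alpha.
Proof.
move=> DP; rewrite [in RHS]/coeff /form_eval scaler_suml.
by apply: eq_bigr => p _; rewrite (derivation_curve_eq DP p.2) scalerA.
Qed.

Lemma form_eq_coeff w1 w2 : form_eq s w1 w2 <-> coeff w1 = coeff w2.
Proof.
split=> [E|E M D DP]; first exact: E ham_derivation.
by rewrite (form_eval_coeff w1 DP) (form_eval_coeff w2 DP) E.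
Qed.

Lemma coeff_cat w1 w2 : coeff (w1 ++ w2) = coeff w1 + coeff w2.
Proof. exact: big_cat. Qed.

Lemma coeff_scale f w : coeff (form_scale f w) = f * coeff w.
Proof.
rewrite /coeff /form_eval big_map mulr_sumr.
by apply: eq_bigr => p _; exact: esym (mulrA _ _ _).
Qed.

Lemma coeff_d g : coeff (form_d g) = ham g.
Proof. by rewrite /coeff /form_eval big_seq1 scale1r. Qed.

Lemma H1dR_eq_coeff w1 w2 :
  H1dR_eq s w1 w2 <-> exists g, coeff w1 = coeff w2 + ham g.
Proof.
by split=> -[g E]; exists g; move: E; rewrite form_eq_coeff coeff_cat coeff_d.
Qed.

(** As L_X (p dq) = X(p) dq + p d(X q), the only correction to X acting on the
    coefficient p H(q) comes from the commutator of H and X. *)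
Lemma coeff_lie_derivative (X : A -> A) c w :
  derivation_along idfun X -> (forall f, ham (X f) = X (ham f) + c * ham f) ->
  coeff (lie_derivative X w) = X (coeff w) + c * coeff w.
Proof.
move=> XP comm; have X0 := along0 XP; have [XD XM] := XP.
rewrite /lie_derivative; elim: w => [|p w IHw].
  by rewrite /coeff /form_eval big_nil X0 mulr0 addr0.
have E q v : coeff (q :: v) = q.1 * ham q.2 + coeff v by exact: big_cons.
rewrite /= !E IHw /= XD XM comm /=; ring.
Qed.

(** The commutator of H with a lift of a vector field is linear over the base,
    hence can be compared with c H on the generators x and y. *)
Lemma ham_commutator (X : A -> A) (V : k -> k) c :
  derivation_along idfun X -> (forall u, X (s u) = s (V u)) ->
  ham (X x) = X y + c * y -> ham (X y) = X (ham y) + c * ham y ->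
  forall f, ham (X f) = X (ham f) + c * ham f.
Proof.
move=> XP Xs Ex Ey f; have X0 := along0 XP.
have [XD XM] := XP; have [hD hM] := ham_along.
have D1 : derivation s ((fun f => ham (X f) - X (ham f)) : A -> A^o).
  split=> [u v|u v|u]; first by rewrite XD !hD XD; ring.
    by rewrite XM !hD !hM XD !XM /GRing.scale /=; ring.
  by rewrite Xs !ham_scalar X0 subr0.
have D2 : derivation s ((fun f => c * ham f) : A -> A^o).
  split=> [u v|u v|u]; first by rewrite hD mulrDr.
    by rewrite hM /GRing.scale /=; ring.
  by rewrite ham_scalar mulr0.
have Dx : ham (X x) - X (ham x) = c * ham x.
  by rewrite ham_x Ex addrAC subrr add0r.
have Dy : ham (X y) - X (ham y) = c * ham y.
  by rewrite Ey addrAC subrr add0r.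
have E := derivation_curve_ext D1 D2 Dx Dy f; cbv beta in E.
by rewrite -E addrC subrK.
Qed.

(** Cartan's formula L_Y w = d (iota_Y w) for a vertical field Y: by freeness
    Y = e H, and [H, e H] = H(e) H. *)
Lemma coeff_lie_vertical (Y : A -> A) : derivation s (Y : A -> A^o) ->
  exists e, forall w, coeff (lie_derivative Y w) = ham (e * coeff w).
Proof.
move=> YP; exists (form_eval (Y : A -> A^o) alpha) => w.
have YE f : Y f = ham f * form_eval (Y : A -> A^o) alpha.
  exact: derivation_curve_eq YP f.
move: (form_eval _ alpha) YE => e YE.
have [YD YM Ys] := YP; have [hD hM] := ham_along.
rewrite (@coeff_lie_derivative _ (ham e)).
- by rewrite YE hM /=; ring.
- by split; [exact: YD|exact: YM].
- by move=> f; rewrite !YE hM /=; ring.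
Qed.

Lemma coeff_lieD (X Y Z : A -> A) w : derivation_along idfun Y ->
  (forall f, Z f = X f + Y f) ->
  coeff (lie_derivative Z w)
  = coeff (lie_derivative X w) + coeff (lie_derivative Y w).
Proof.
move=> YP ZE; have [hD _] := ham_along.
rewrite /lie_derivative; elim: w => [|p w IHw].
  by rewrite /coeff /form_eval !big_nil addr0.
have E q v : coeff (q :: v) = q.1 * ham q.2 + coeff v by exact: big_cons.
by rewrite /= !E IHw /= !ZE hD; ring.
Qed.

Lemma curve_map_inj (p : {poly {poly k}}) :
  (size p <= 2)%N -> curve_map a b p = 0 -> p = 0.
Proof.
move=> sp E.
have <- : in_qpoly (weierstrass a b) p = p :> {poly {poly k}}.
  by apply: in_qpoly_small; rewrite mk_monic_weierstrass size_weierstrass.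
exact: (congr1 (fun f : A => val f : {poly {poly k}}) E).
Qed.

Lemma ham_polyx (p : {poly k}) :
  ham (curve_map a b p%:P) = curve_map a b p^`()%:P * y.
Proof.
have [hD hM] := ham_along.
elim/poly_ind: p => [|p c IHp].
  have -> : curve_map a b 0%:P = s 0 by rewrite !rmorph0.
  by rewrite ham_scalar deriv0 !rmorph0 mul0r.
rewrite derivMXaddC !rmorphD !rmorphM hD hM IHp.
have -> : curve_map a b 'X%:P = x by [].
have -> : curve_map a b c%:P%:P = s c by [].
by rewrite ham_scalar ham_x /=; ring.
Qed.

Hypothesis char0 : forall n (c : k), n.+1%:R * c = 0 -> c = 0.

(** If p has degree n and leading coefficient l, the left-hand side has degree
    n + 2 and leading coefficient (8 n + 12) l, whereas the right-hand side
    has degree at most one. *)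
Lemma weierstrass_ode (p : {poly k}) (f h : k) :
  2%:R * p^`() * (4%:R *: 'X^3 - a *: 'X - b%:P) + p * (12%:R *: 'X^2 - a%:P)
  = f%:P + h *: 'X -> p = 0.
Proof.
move=> E; apply/eqP/negP => /negP p0.
have [n sn] : exists n, size p = n.+1.
  by exists (size p).-1; rewrite prednK // size_poly_gt0.
suff : p`_n = 0.
  by move/eqP; rewrite -[n]/(n.+1.-1) -sn -lead_coefE lead_coef_eq0 (negPf p0).
have pz m : (n < m)%N -> p`_m = 0 by move=> nm; apply: nth_default; rewrite sn.
(* Only the terms p' X^3 and p X^2 reach the degree n + 2. *)
have lhsE : 2%:R * p^`() * (4%:R *: 'X^3 - a *: 'X - b%:P)
    + p * (12%:R *: 'X^2 - a%:P)
  = 8%:R *: (p^`() * 'X^3) + 12%:R *: (p * 'X^2)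
    - ((2%:R * a) *: (p^`() * 'X) + (2%:R * b) *: p^`() + a *: p).
  by rewrite -!mul_polyC; ring.
move/(congr1 (fun q : {poly k} => q`_n.+2)): E.
rewrite lhsE !coefD coefN !coefD !coefZ !coefMXn coefMX !coef_deriv.
rewrite coefC coefX /=.
have [-> ->] : p`_n.+2 = 0 /\ p`_n.+3 = 0.
  by split; apply: pz; rewrite ltnW ?ltnS.
rewrite !mul0rn !mulr0 !addr0 subr0 !subn2 /= => E.
apply: (char0 (n := 8 * n + 11)).
rewrite -[RHS]E {E}; case: n {sn pz} => [|n] /=.
  by rewrite ?mulr0 ?add0r.
rewrite subSS subn2 /= -mulr_natl.
have -> : (8 * n.+1 + 11).+1%:R = 8%:R * n.+1%:R + 12%:R :> k.
  by rewrite -natrM -natrD; congr (_%:R); rewrite -addnS.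
by ring.
Qed.

(** The classes of dx/y and x dx/y are independent in H^1_dR.  The part without
    y of H (g0 + g1 y) is g1' P + g1 P' / 2, so that an exact form f + h x
    gives an equation excluded by the degree count above. *)
Lemma cohomology_free (f h : k) g : s f + s h * x = ham g -> f = 0 /\ h = 0.
Proof.
have [hD hM] := ham_along; move=> E.
pose p : {poly {poly k}} := val g.
have [g0 [g1 gE]] : exists g0 g1 : {poly k}, p = g0%:P + g1%:P * 'X.
  exists p`_0, p`_1; apply/polyP => -[|[|i]].
  - by rewrite coefD coefC coefMX addr0.
  - by rewrite coefD coefC coefMX coefC add0r.
  rewrite coefD coefC coefMX coefC /= addr0; apply: nth_default.
  have : (size p < size (mk_monic (weierstrass a b)))%N := size_mk_monic g.
  by rewrite mk_monic_weierstrass size_weierstrass ltnS => /leq_trans; apply.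
pose P : {poly k} := 4%:R *: 'X^3 - a *: 'X - b%:P.
pose P' : {poly k} := 12%:R *: 'X^2 - a%:P.
pose q := g1^`() * P + half%:P * (g1 * P') - (f%:P + h%:P * 'X).
pose em : {rmorphism {poly k} -> A} := curve_map a b \o polyC.
have emX : em 'X = x by [].
have emC c : em c%:P = s c by [].
have PE : curve_map a b P%:P = y ^+ 2.
  rewrite curve_eq -[LHS]/(em P) /P -!mul_polyC !polyC_natr.
  rewrite !rmorphB !(rmorphM em _%:R) ?(rmorphM em a%:P) rmorphXn rmorph_nat.
  by rewrite emX !emC.
have P'E : curve_map a b P'%:P = 12%:R * x ^+ 2 - s a.
  rewrite -[LHS]/(em P') /P' -!mul_polyC !polyC_natr.
  rewrite !rmorphB !(rmorphM em _%:R) ?(rmorphM em a%:P) rmorphXn rmorph_nat.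
  by rewrite emX !emC.
have F0 : curve_map a b (q%:P + (g0^`())%:P * 'X) = 0.
  have -> : curve_map a b (q%:P + (g0^`())%:P * 'X) = em q + em g0^`() * y.
    by rewrite rmorphD rmorphM.
  have -> : em q = em g1^`() * em P + em half%:P * (em g1 * em P')
                   - (em f%:P + em h%:P * em 'X).
    rewrite /q; clear q PE P'E.
    move: P P' half%:P f%:P h%:P 'X => u1 u2 u3 u4 u5 u6.
    by rewrite rmorphB !rmorphD !rmorphM.
  have -> : em P = y ^+ 2 := PE.
  have -> : em P' = 12%:R * x ^+ 2 - s a := P'E.
  rewrite emX !emC E.
  have -> : g = em g0 + em g1 * y.
    by rewrite -(curve_map_val g) -/p gE rmorphD rmorphM.
  have hamE r : ham (em r) = em r^`() * y := ham_polyx r.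
  by rewrite hD hM !hamE ham_y; ring.
have sF : (size (q%:P + (g0^`())%:P * 'X)%R <= 2)%N.
  by rewrite addrC size_MXaddC; case: ifP => // _; rewrite ltnS size_polyC_leq1.
have q0 : q = 0.
  have := congr1 (fun r : {poly {poly k}} => r`_0) (curve_map_inj sF F0).
  by rewrite /= coefD coefC coefMX coef0 addr0.
have qE : g1^`() * P + half%:P * (g1 * P') = f%:P + h%:P * 'X.
  by apply/eqP; rewrite -subr_eq0 -/q q0.
have hP : 2%:R * half%:P = 1 :> {poly k} by rewrite -polyC_natr -polyCM halfP.
have g10 : g1 = 0.
  apply: (@weierstrass_ode _ (2%:R * f) (2%:R * h)).
  have -> : (2%:R * f)%:P + (2%:R * h) *: 'X = 2%:R * (f%:P + h%:P * 'X).
    by rewrite -mul_polyC; ring.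
  rewrite -qE; have -> : 2%:R * (g1^`() * P + half%:P * (g1 * P'))
    = 2%:R * g1^`() * P + (2%:R * half%:P) * (g1 * P') by ring.
  by rewrite hP mul1r.
move: qE; rewrite g10 deriv0 !mul0r mulr0 addr0 => /esym fh0.
split.
  by have := congr1 (fun r : {poly k} => r`_0) fh0;
     rewrite /= coefD coefC coefMX coef0 addr0.
by have := congr1 (fun r : {poly k} => r`_1) fh0;
   rewrite /= coefD coefC coefMX coefC coef0 add0r.
Qed.

End Cohomology.

(** * The Gauss-Manin matrix of a vector field *)

Section GaussManinMatrix.

Variables (C k : comNzRingType) (j : {rmorphism C -> k}).
Variables (a b d half t : k).
Hypothesis dP : d * (27%:R * b ^+ 2 - a ^+ 3) = 1.
Hypothesis halfP : 2%:R * half = 1.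
Hypothesis char0 : forall n (c : k), n.+1%:R * c = 0 -> c = 0.

Local Notation A := (curve_ring a b).
Local Notation s := (curve_scalar a b).
Local Notation x := (curve_x a b).
Local Notation y := (curve_y a b).
Local Notation alpha := (dx_over_y a b d).
Local Notation beta := (form_scale (s t) alpha ++ form_scale x alpha).
Local Notation ham := (@ham k a b half).
Local Notation coeff := (@coeff k a b half).

Lemma vector_field_along (V : k -> k) :
  vector_field j V -> derivation_along idfun V.
Proof. by case=> VD VM _; split; [exact: VD|exact: VM]. Qed.

Section Field.

Variables (V : k -> k) (B D : k).
Hypothesis VP : vector_field j V.
Hypothesis Va : V a = 4%:R * B * a + 72%:R * D * b.
Hypothesis Vb : V b = 6%:R * B * b + 4%:R * D * a ^+ 2.

Let VA := vector_field_along VP.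

Local Notation liftx := (2%:R * s B * x + s D * (24%:R * x ^+ 2 - 4%:R * s a)).
Local Notation lifty := (3%:R * s B * y + 36%:R * s D * x * y).

(** The lift has to satisfy 2 y X(y) = P' X(x) - V(a) x - V(b).  Looking for
    X(y) = r(x) y turns this into the identity of polynomials in x
    2 r P = P' X(x) - V(a) x - V(b); it holds for the Euler field (4 a, 6 b)
    with X(x) = 2 x, r = 3, and for the field (72 b, 4 a^2) with
    X(x) = 24 x^2 - 4 a, r = 36 x. *)
Definition field_lift : A -> A := curve_lift V liftx lifty.

Lemma field_lift_tangent : 2%:R * y * lifty =
  (12%:R * x ^+ 2 - s a) * liftx - s (V a) * x - s (V b).
Proof.
have Ea : s (V a) = 4%:R * s B * s a + 72%:R * s D * s b.
  by rewrite Va rmorphD !(rmorphM s) !(rmorph_nat s).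
have Eb : s (V b) = 6%:R * s B * s b + 4%:R * s D * s a ^+ 2.
  by rewrite Vb !expr2 rmorphD !(rmorphM s) !(rmorph_nat s).
rewrite {}Ea {}Eb; have := curve_eq a b.
move: (s a) (s b) (s B) (s D) x y => a' b' B' D' x' y' yE.
have -> : 2%:R * y' * (3%:R * B' * y' + 36%:R * D' * x' * y')
   = (6%:R * B' + 72%:R * D' * x') * y' ^+ 2 by ring.
by rewrite yE; ring.
Qed.

Let lift_along : derivation_along idfun field_lift :=
  curve_lift_along VA field_lift_tangent.
Let lift_s c : field_lift (s c) = s (V c) :=
  curve_lift_scalar VA field_lift_tangent c.
Let lift_x : field_lift x = liftx :=
  curve_lift_x VA field_lift_tangent.
Let lift_y : field_lift y = lifty :=
  curve_lift_y VA field_lift_tangent.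

Lemma field_lift_lifts : lifts j s V field_lift.
Proof.
have [LD LM] := lift_along; have [_ _ Vj] := VP.
split=> [|c]; last exact: lift_s.
by split=> [u v|u v|c]; [exact: LD|exact: LM|rewrite /= [LHS]lift_s Vj rmorph0].
Qed.

(** With u = X(x) and X(y) = r y one has [H, X] = (du/dx - r) H; here
    du/dx - r is 2 - 3 for the Euler field and 48 x - 36 x for the other one. *)
Lemma field_lift_commutator f :
  ham (field_lift f) = field_lift (ham f) + (12%:R * s D * x - s B) * ham f.
Proof.
have [hD hM] := ham_along a b halfP; have hN := alongN (ham_along a b halfP).
have h0 := ham_scalar a b halfP.
have hs c g : ham (s c * g) = s c * ham g by rewrite hM h0 mulr0 addr0.
have [LD LM] := lift_along; have LN := alongN lift_along.
have V1 : V half = 0.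
  apply: (char0 (n := 1)); have := along_natM VA 2 half => <-.
  by rewrite halfP (along1 VA).
have hx := ham_x a b halfP; have hy := ham_y a b halfP.
apply: (ham_commutator halfP lift_along lift_s) f.
  have -> : field_lift x =
      s (2%:R * B) * x + (s (24%:R * D) * (x * x) - s (4%:R * D * a)).
    by rewrite lift_x; ring.
  by rewrite lift_y !hD hN !hs hM h0 hx /idfun; ring.
have -> : field_lift y = s (3%:R * B) * y + s (36%:R * D) * (x * y).
  by rewrite lift_y; ring.
have -> : field_lift (ham y) =
    s half * (12%:R * (2%:R * x * field_lift x) - s (V a)).
  have -> : ham y = s half * (s 12%:R * (x * x) - s a).
    by rewrite hy rmorph_nat expr2.
  rewrite [LHS]LM LD LN LM LM !lift_s V1 (along_nat VA) rmorph0 rmorph_nat.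
  rewrite /idfun.
  by ring.
rewrite hD !hs hM hx hy lift_x Va /idfun.
have yy : y * y = 2%:R * s half * (4%:R * x ^+ 3 - s a * x - s b).
  by rewrite (scalar_halfP a b halfP) mul1r -curve_eq expr2.
by rewrite yy; ring.
Qed.

(** The connection may be computed with the polynomial lift: any other lift
    differs from it by a vertical field, which contributes an exact form. *)
Lemma gauss_manin_coeff w1 w2 : gauss_manin j s V w1 w2 <->
  exists g, field_lift (coeff w1) + (12%:R * s D * x - s B) * coeff w1
            = coeff w2 + ham g.
Proof.
have [hD hM] := ham_along a b halfP.
have hN := alongN (ham_along a b halfP).
have lieE := coeff_lie_derivative _ lift_along field_lift_commutator.
split=> [[X [[XP Xs]]]|[g E]]; last first.
  exists field_lift; split; first exact: field_lift_lifts.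
  by apply/(H1dR_eq_coeff dP halfP); exists g; rewrite lieE.
move/(H1dR_eq_coeff dP halfP) => [g E].
have [XD XM _] := XP; have [LD LM] := lift_along.
have YP : derivation s ((fun f => X f - field_lift f) : A -> A^o).
  split=> [u v|u v|c]; first by rewrite XD LD; ring.
    by rewrite XM LM /GRing.scale /=; ring.
  by rewrite Xs lift_s subrr.
have [e eP] := coeff_lie_vertical dP halfP YP.
have YA : derivation_along idfun ((fun f => X f - field_lift f) : A -> A).
  by have [YD YM _] := YP; split; [exact: YD|exact: YM].
exists (g - e * coeff w1).
rewrite hD hN addrA -E.
rewrite (@coeff_lieD _ _ _ _ halfP field_lift _ X w1 YA); last first.
  by move=> f; rewrite addrC subrK.
by rewrite eP lieE addrK.
Qed.

Lemma coeff_alpha : coeff alpha = 1.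
Proof. exact: ham_alpha dP halfP. Qed.

Lemma coeff_beta : coeff beta = s t + x.
Proof. by rewrite coeff_cat !coeff_scale coeff_alpha !mulr1. Qed.

Lemma cohomology_freeP (f h : k) :
  (exists g, s f + s h * x = ham g) <-> f = 0 /\ h = 0.
Proof.
split=> [[g E]|[-> ->]]; first exact: (cohomology_free (g := g) halfP char0 E).
exists (s 0); rewrite (ham_scalar a b halfP); ring.
Qed.

Lemma gauss_manin_alpha m0 m1 w : coeff w = s m0 + s m1 * (s t + x) ->
  gauss_manin j s V alpha w <-> B = - (m0 + m1 * t) /\ 12%:R * D = m1.
Proof.
move=> Ew; rewrite gauss_manin_coeff coeff_alpha Ew.
have E : field_lift 1 + (12%:R * s D * x - s B) * 1 - (s m0 + s m1 * (s t + x))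
  = s (- (B + (m0 + m1 * t))) + s (12%:R * D - m1) * x.
  have -> : field_lift 1 = 0 by exact: along1 lift_along.
  by rewrite add0r; ring.
transitivity
  (exists g, s (- (B + (m0 + m1 * t))) + s (12%:R * D - m1) * x = ham g).
  split=> -[g Eg]; exists g; first by rewrite -E Eg addrAC subrr add0r.
  by rewrite -Eg -E [RHS]addrC subrK.
rewrite cohomology_freeP; split=> -[E1 E2]; split.
- by apply/eqP; rewrite -addr_eq0; apply/eqP/oppr_inj; rewrite E1 oppr0.
- by apply/eqP; rewrite -subr_eq0 E2.
- by rewrite E1 addNr oppr0.
- by rewrite E2 subrr.
Qed.

(** The Lie derivative of x dx/y has coefficient B x + D (36 x^2 - 4 a), and
    x^2 is removed by the exact form 6 D dy, whose coefficient is
    D (36 x^2 - 3 a). *)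
Lemma gauss_manin_beta m0 m1 w : coeff w = s m0 + s m1 * (s t + x) ->
  gauss_manin j s V beta w <->
  V t = m0 + m1 * t + D * a + B * t /\ B + 12%:R * D * t = m1.
Proof.
move=> Ew; rewrite gauss_manin_coeff coeff_beta Ew.
have [hD hM] := ham_along a b halfP; have h0 := ham_scalar a b halfP.
have hN := alongN (ham_along a b halfP).
have [LD LM] := lift_along.
have hy : ham (6%:R * s D * y) = s D * (3%:R * (12%:R * x ^+ 2 - s a)).
  have -> : 6%:R * s D = s (6%:R * D) by rewrite rmorphM rmorph_nat.
  rewrite hM h0 mulr0 addr0 (ham_y a b halfP) /idfun.
  have hh := scalar_halfP a b halfP.
  have -> : s D * (3%:R * (12%:R * x ^+ 2 - s a))
          = 2%:R * s half * s D * (3%:R * (12%:R * x ^+ 2 - s a)).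
    by rewrite hh mul1r.
  by ring.
have E : field_lift (s t + x) + (12%:R * s D * x - s B) * (s t + x)
     - (s m0 + s m1 * (s t + x)) - ham (6%:R * s D * y)
  = s (V t - (m0 + m1 * t + D * a + B * t)) + s (B + 12%:R * D * t - m1) * x.
  rewrite LD lift_s lift_x hy; ring.
transitivity (exists g, s (V t - (m0 + m1 * t + D * a + B * t))
                        + s (B + 12%:R * D * t - m1) * x = ham g).
  split=> -[g Eg].
    exists (g - 6%:R * s D * y); rewrite -E Eg hD hN; ring.
  exists (g + 6%:R * s D * y); rewrite hD -Eg -E; ring.
rewrite cohomology_freeP; split=> -[/eqP E1 /eqP E2]; split; apply/eqP.
- by rewrite -subr_eq0.
- by rewrite -subr_eq0.
- by rewrite subr_eq0.
- by rewrite subr_eq0.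
Qed.

End Field.

(** Cramer's rule; half ^+ 4 * d is the inverse of 16 (27 b^2 - a^3), the
    opposite of the determinant of the system. *)
Lemma field_coordinates (u v : k) : exists B D : k,
  u = 4%:R * B * a + 72%:R * D * b /\ v = 6%:R * B * b + 4%:R * D * a ^+ 2.
Proof.
exists (- half ^+ 4 * d * (4%:R * a ^+ 2 * u - 72%:R * b * v)).
exists (- half ^+ 4 * d * (4%:R * a * v - 6%:R * b * u)).
have E : (2%:R * half) ^+ 4 * (d * (27%:R * b ^+ 2 - a ^+ 3)) = 1.
  by rewrite halfP dP expr1n mulr1.
split.
  transitivity ((2%:R * half) ^+ 4 * (d * (27%:R * b ^+ 2 - a ^+ 3)) * u).
    by rewrite E mul1r.
  by ring.
transitivity ((2%:R * half) ^+ 4 * (d * (27%:R * b ^+ 2 - a ^+ 3)) * v).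
  by rewrite E mul1r.
by ring.
Qed.

End GaussManinMatrix.

(** * Vector fields on the moduli space *)

Section Localization.

Variables (B E : comNzRingType) (phi : {rmorphism B -> E}) (q : B) (qinv : E).
Hypothesis phi_inj : injective phi.
Hypothesis qinvP : qinv * phi q = 1.
Hypothesis fractions : forall e, exists p n, e * phi q ^+ n = phi p.

Lemma localization_denom e : exists p r ri, e * phi r = phi p /\ phi r * ri = 1.
Proof.
have [p [n E1]] := fractions e; exists p, (q ^+ n), (qinv ^+ n).
by rewrite rmorphXn E1 -exprMn [phi q * _]mulrC qinvP expr1n.
Qed.

Lemma localization_ext (V1 V2 : E -> E) :
  derivation_along idfun V1 -> derivation_along idfun V2 ->
  (forall p, V1 (phi p) = V2 (phi p)) -> V1 =1 V2.
Proof.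
move=> [_ M1] [_ M2] E12 e.
have [p [r [ri [E1 E2]]]] := localization_denom e.
have := E12 p; rewrite -E1 M1 M2 E12 => /addrI /(congr1 (fun u => u * ri)).
by rewrite /= -!(mulrAC _ ri) E2 !mul1r.
Qed.

Variable D : B -> E.
Hypothesis DP : derivation_along phi D.

(** The quotient rule.  V(e) is characterised by V(e) phi(r) + e D(r) = D(p)
    for every way of writing e as phi(p) / phi(r); the choice of a fraction
    for each e is then harmless, and the derivation rules reduce to those
    of D after clearing denominators. *)
Lemma localization_derivation : exists V : E -> E,
  derivation_along idfun V /\ forall p, V (phi p) = D p.
Proof.
have [DD DM] := DP.
have pre e : exists u p r ri, [/\ e * phi r = phi p, phi r * ri = 1
    & u * phi r + e * D r = D p].
  have [p [r [ri [E1 E2]]]] := localization_denom e.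
  exists ((D p - e * D r) * ri), p, r, ri; split=> //.
  by rewrite -mulrA [ri * _]mulrC E2 mulr1 subrK.
have [V VP] := choice pre.
have VE e p r : e * phi r = phi p -> V e * phi r + e * D r = D p.
  move=> E1; have [p0 [r0 [i0 [F1 F2 F3]]]] := VP e.
  have E0 : p0 * r = p * r0.
    by apply: phi_inj; rewrite !rmorphM -F1 -E1 mulrAC.
  have := congr1 D E0; rewrite !DM -F1 -E1 -F3 => E2.
  rewrite -[LHS]mulr1 -[RHS]mulr1 -F2 !mulrA; congr (_ * i0).
  apply: (@addrI _ (e * phi r * D r0)).
  by rewrite [D p * _]mulrC -E2; ring.
have reg r1 i1 r2 i2 u v : phi r1 * i1 = 1 -> phi r2 * i2 = 1 ->
    u * (phi r1 * phi r2) = v * (phi r1 * phi r2) -> u = v.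
  move=> F1 F2 /(congr1 (fun w => w * (i1 * i2))) /=.
  have regE w : w * (phi r1 * phi r2) * (i1 * i2)
                = w * ((phi r1 * i1) * (phi r2 * i2)) by ring.
  by rewrite !regE F1 F2 !mulr1.
exists V; split=> [|p]; last first.
  have := @VE (phi p) p 1; rewrite rmorph1 !mulr1 (along1 DP) mulr0 addr0.
  by apply.
split=> e1 e2.
all: have [p1 [r1 [i1 [E1 F1 G1]]]] := VP e1.
all: have [p2 [r2 [i2 [E2 F2 G2]]]] := VP e2.
all: apply: (reg _ _ _ _ _ _ F1 F2).
  have := @VE (e1 + e2) (p1 * r2 + p2 * r1) (r1 * r2).
  rewrite rmorphD !rmorphM -E1 -E2 DD !DM -G1 -G2 -E1 -E2 => H.
  apply: (@addIr _ ((e1 + e2) * (phi r1 * D r2 + phi r2 * D r1))).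
  rewrite H; ring.
have := @VE (e1 * e2) (p1 * p2) (r1 * r2).
rewrite !rmorphM !DM -G1 -G2 -E1 -E2 => H.
apply: (@addIr _ ((e1 * e2) * (phi r1 * D r2 + phi r2 * D r1))).
rewrite H /=; ring.
Qed.

End Localization.

Section Moduli.

Variable R : realType.
Local Notation C := R[i].
Local Notation OT := (OT R).
Local Notation OT_poly := (@OT_poly R).
Local Notation OT_const := (@OT_const R).
Local Notation discr := (discr R).

Lemma OT_poly_inj : injective OT_poly.
Proof. by move=> p q /(congr1 val) /= /eqP; rewrite tofrac_eq => /eqP. Qed.

Lemma inv_discr_poly : inv_discr R * OT_poly discr = 1.
Proof. by apply: val_inj; rewrite /= mulVf // tofrac_eq0 discr_neq0. Qed.

Lemma OT_fraction (f : OT) : exists p n, f * OT_poly discr ^+ n = OT_poly p.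
Proof.
have /asboolP[p [n E]] := valP f; exists p, n; apply: val_inj.
rewrite rmorphM rmorphXn /= [X in X * _]E divfK //.
by rewrite expf_neq0 // tofrac_eq0 discr_neq0.
Qed.

Lemma ord3P (P : 'I_3 -> Prop) :
  P (inord 0) -> P (inord 1) -> P (inord 2) -> forall i, P i.
Proof.
move=> P0 P1 P2 i; rewrite -(inord_val i).
by case: i => -[|[|[|]]].
Qed.

Lemma vector_field_ext (V1 V2 : OT -> OT) :
  vector_field OT_const V1 -> vector_field OT_const V2 ->
  V1 (t1 R) = V2 (t1 R) -> V1 (t2 R) = V2 (t2 R) -> V1 (t3 R) = V2 (t3 R) ->
  V1 = V2.
Proof.
move=> V1P V2P Et1 Et2 Et3; apply: funext.
have A1 := vector_field_along V1P; have A2 := vector_field_along V2P.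
apply: (localization_ext inv_discr_poly OT_fraction A1 A2) => p.
have [D1 M1] := A1; have [D2 M2] := A2.
have [_ _ c1] := V1P; have [_ _ c2] := V2P.
have constE c : V1 (OT_poly c%:MP) = V2 (OT_poly c%:MP).
  by rewrite [LHS]c1 [RHS]c2.
have mulE u v : V1 (OT_poly u) = V2 (OT_poly u) ->
    V1 (OT_poly v) = V2 (OT_poly v) ->
    V1 (OT_poly (u * v)) = V2 (OT_poly (u * v)).
  by move=> Eu Ev; rewrite rmorphM M1 M2 Eu Ev.
rewrite [p]mpolyE; elim/big_ind: _ => [|u v Eu Ev|m _].
- exact: constE 0.
- by rewrite rmorphD D1 D2 Eu Ev.
rewrite -mul_mpolyC; apply: (mulE); first exact: constE.
have XE i : V1 (OT_poly 'X_i) = V2 (OT_poly 'X_i) by move: i; apply: ord3P.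
rewrite mpolyXE_id; elim/big_ind: _ => [|//|i _]; first exact: constE 1.
elim: (m i) => [|n IHn]; first by rewrite expr0; exact: constE 1.
by rewrite exprS; apply: (mulE).
Qed.

Lemma vector_field_exists (v1 v2 v3 : OT) : exists V : OT -> OT,
  [/\ vector_field OT_const V, V (t1 R) = v1, V (t2 R) = v2 & V (t3 R) = v3].
Proof.
pose v (i : 'I_3) := nth 0 [:: v1; v2; v3] i.
pose D (p : {mpoly C[3]}) : OT := \sum_(i < 3) v i * OT_poly (mderiv i p).
have DP : derivation_along OT_poly D.
  split=> p q; rewrite /D.
    rewrite -big_split /=; apply: eq_bigr => i _.
    by rewrite mderivD rmorphD mulrDr.
  rewrite !mulr_sumr -big_split /=; apply: eq_bigr => i _.
  by rewrite mderivM rmorphD !rmorphM; ring.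
have DX i : D 'X_i = v i.
  rewrite /D (bigD1 i) //= big1 => [|l li].
    have submU : (U_(i) - U_(i) = 0 :> 'X_{1..3})%MM.
      by apply/mnmP => l; rewrite !mnmE subnn.
    by rewrite mderivX mnmE eqxx scale1r submU mpolyX0 rmorph1 mulr1 addr0.
  by rewrite mderivX mnmE eq_sym (negPf li) scale0r rmorph0 mulr0.
have [V [VP VE]] :=
  localization_derivation OT_poly_inj inv_discr_poly OT_fraction DP.
have [VD VM] := VP.
exists V; split; rewrite ?VE ?DX /v ?inordK //.
split; [exact: VD|exact: VM|move=> c].
rewrite [LHS]VE /D big1 // => i _.
by rewrite mderivC rmorph0 mulr0.
Qed.

Definition OT_half : OT := OT_const 2%:R^-1.

Lemma OT_halfP : 2%:R * OT_half = 1.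
Proof.
rewrite /OT_half -(rmorph_nat OT_const 2) -rmorphM mulfV ?rmorph1 //.
by rewrite Num.Theory.pnatr_eq0.
Qed.

Lemma OT_char0 n (c : OT) : n.+1%:R * c = 0 -> c = 0.
Proof.
move=> /(congr1 (fun u => OT_const n.+1%:R^-1 * u)).
rewrite mulr0 mulrA -(rmorph_nat OT_const) -rmorphM mulVf ?rmorph1 ?mul1r //.
by rewrite Num.Theory.pnatr_eq0.
Qed.

End Moduli.

(** * The AMSY Lie algebra is traceless *)

Section TraceZero.

Variable F : fieldType.

(** The symplectic condition in rank two says that the determinant is 1. *)
Lemma group_G_det (K : comNzRingType) (M : 'M[K]_2) : group_G M ->
  M 0 0 * M 1 1 = 1.
Proof.
case=> [/matrixP /(_ 0 1) + M10].
rewrite !mxE !big_ord_recl big_ord0 !mxE !big_ord_recl !big_ord0 !mxE /=.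
rewrite [lift _ _](_ : _ = 1); last exact: val_inj.
have -> : ord0 = 0 :> 'I_2 by [].
by move=> E; rewrite -[RHS]subr0 -E M10; ring.
Qed.

(** To first order, (1 + eps x_00) (1 + eps x_11) = 1 + eps tr x. *)
Lemma Lie_G_trace (x : 'M[F]_2) : Lie_G x -> \tr x = 0.
Proof.
move/group_G_det; set M := _ + _ => E.
have Mdiag i : M i i = in_qpoly 'X^2 (1 + x i i *: 'X).
  by rewrite !mxE eqxx mulr1n in_qpolyD in_qpoly1.
pose P := (1 + x 0 0 *: 'X) * (1 + x 1 1 *: 'X).
have {E} : in_qpoly 'X^2 P = 1 by rewrite in_qpolyM -!Mdiag.
move=> /(congr1 (fun u : {poly %/ 'X^2} => val u : {poly F})) /=.
rewrite mk_monic_Xn => E.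
have := Pdiv.RingMonic.rdivp_eq (monicXn F 2) P.
rewrite E => /(congr1 (fun u : {poly F} => u`_1)) /=.
rewrite coefD coefMXn coefC /= addr0 => <-.
have -> : P = 1 + (x 0 0 + x 1 1)%:P * 'X + (x 0 0 * x 1 1)%:P * 'X^2.
  by rewrite /P -!mul_polyC; ring.
rewrite 2!coefD coef1 coefMX coefMXn coefC /= add0r addr0.
rewrite /mxtrace !big_ord_recl big_ord0 addr0.
by rewrite [lift _ _](_ : _ = 1); last exact: val_inj.
Qed.

(** sl_2 is a Lie subalgebra, stable under transposition, which contains the
    Lie algebra of G and therefore its nilradical. *)
Lemma amsy_trace (g : 'M[F]_2) : amsy g -> \tr g = 0.
Proof.
pose sl := lker (linfun (mxtrace : 'M[F]_2 -> F^o)).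
have slE x : (x \in sl) = (\tr x == 0) by rewrite memv_ker lfunE.
move=> /(_ sl) gP; apply/eqP; rewrite -slE; apply: gP => [x y _ _|x].
  by rewrite slE /lie_bracket linearB /= [\tr (y *m x)]mxtrace_mulC subrr.
rewrite slE => -[/Lie_G_trace->//|[y [I [[IG _] _ yI]] ->]].
by rewrite mxtrace_tr (Lie_G_trace (IG y yI)).
Qed.

End TraceZero.

(** * Constant matrices in the frame alpha, beta *)

Section Frame.

Variable R : realType.
Local Notation C := R[i].
Local Notation K := (@OT_const R).
Local Notation s := (@OE_scalar R).
Local Notation coeff := (@coeff _ (t2 R) (t3 R) (OT_half R)).

Lemma coeff_mx_frame (M : 'M[C]_2) (i : 'I_2) :
  coeff (mx_frame M i)
  = s (K (M i 0)) + s (K (M i 1)) * (s (t1 R) + curve_x (t2 R) (t3 R)).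
Proof.
have aE : coeff (alpha R) = 1 := coeff_alpha (inv_discrE R) (OT_halfP R).
have bE : coeff (beta R) = s (t1 R) + curve_x (t2 R) (t3 R) :=
  coeff_beta (t1 R) (inv_discrE R) (OT_halfP R).
have flat (r : seq 'I_2) (F : 'I_2 -> Defs.form (OE R)) :
    coeff (flatten [seq F l | l <- r]) = \sum_(l <- r) coeff (F l).
  elim: r => [|l r IHr]; first by rewrite big_nil [LHS]big_nil.
  by rewrite big_cons -IHr coeff_cat.
rewrite flat big_enum /= !big_ord_recl big_ord0 !coeff_scale addr0.
have -> : lift ord0 ord0 = 1 :> 'I_2 by exact: val_inj.
have -> : frame R ord0 = alpha R by [].
have -> : frame R 1 = beta R by [].
by rewrite aE bE; congr (_ + _); exact: mulr1.
Qed.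

Lemma frame_ind (P : 'I_2 -> Prop) : P 0 -> P 1 -> forall i, P i.
Proof.
move=> P0 P1 [[|[|//]] i2]; [move: P0|move: P1]; congr P; exact: val_inj.
Qed.

(** The equations say that M is the Gauss-Manin matrix of V.  The first two
    determine B and D, the third V(t1); the last then forces M to be
    traceless. *)
Lemma gauss_manin_frame (M : 'M[C]_2) (V : OT R -> OT R) (B D : OT R) :
  vector_field K V ->
  V (t2 R) = 4%:R * B * t2 R + 72%:R * D * t3 R ->
  V (t3 R) = 6%:R * B * t3 R + 4%:R * D * t2 R ^+ 2 ->
  (forall i, gauss_manin K s V (frame R i) (mx_frame M i)) <->
  [/\ B = - (K (M 0 0) + K (M 0 1) * t1 R), 12%:R * D = K (M 0 1),
      V (t1 R) = K (M 1 0) + K (M 1 1) * t1 R + D * t2 R + B * t1 R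
    & B + 12%:R * D * t1 R = K (M 1 1)].
Proof.
move=> VP V2 V3.
have aP := gauss_manin_alpha (t := t1 R) (inv_discrE R) (OT_halfP R)
  (@OT_char0 R) VP V2 V3 (coeff_mx_frame M 0).
have bP := gauss_manin_beta (inv_discrE R) (OT_halfP R)
  (@OT_char0 R) VP V2 V3 (coeff_mx_frame M 1).
split=> [GM|[E1 E2 E3 E4]].
  have [E1 E2] := (proj1 aP) (GM 0); have [E3 E4] := (proj1 bP) (GM 1).
  by split.
apply: frame_ind; first exact: (proj2 aP).
exact: (proj2 bP).
Qed.

End Frame.

Theorem theorem3p19 (R : realType) (g : 'M[R[i]]_2) (hg : amsy g) :
  exists! V : OT R -> OT R,
    vector_field (@OT_const R) V /\
    forall i : 'I_2,
      gauss_manin (@OT_const R) (@OE_scalar R) V (frame R i) (mx_frame g^T i).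
Proof.
have tr0 : g^T 0 0 + g^T 1 1 = 0.
  have := amsy_trace hg.
  rewrite -mxtrace_tr /mxtrace !big_ord_recl big_ord0 addr0.
  by have -> : lift ord0 ord0 = 1 :> 'I_2 by exact: val_inj.
move: (g^T) tr0 => M tr0.
pose K := @OT_const R.
have trK : K (M 0 0) = - K (M 1 1).
  by apply/eqP; rewrite -addr_eq0 -(rmorphD K) tr0 rmorph0.
(* B and D are read off from the row of alpha. *)
pose D := K (12%:R^-1 * M 0 1).
pose B := - (K (M 0 0) + K (M 0 1) * t1 R).
have D12 : 12%:R * D = K (M 0 1).
  rewrite /D -(rmorph_nat K) -rmorphM mulrA mulfV ?mul1r //.
  by rewrite Num.Theory.pnatr_eq0.
have [V [VP V1 V2 V3]] := vector_field_exists
  (K (M 1 0) + K (M 1 1) * t1 R + D * t2 R + B * t1 R)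
  (4%:R * B * t2 R + 72%:R * D * t3 R)
  (6%:R * B * t3 R + 4%:R * D * t2 R ^+ 2).
exists V; split.
  split=> //; apply/(gauss_manin_frame M VP V2 V3).
  by split=> //; rewrite D12 /B trK; ring.
move=> W [WP GM].
have [B' [D' [W2 W3]]] :=
  field_coordinates (inv_discrE R) (OT_halfP R) (W (t2 R)) (W (t3 R)).
have [EB ED W1 _] := (proj1 (gauss_manin_frame M WP W2 W3)) GM.
have DE : D' = D.
  apply/eqP; rewrite -subr_eq0; apply/eqP/(OT_char0 (n := 11)).
  by rewrite mulrBr ED D12 subrr.
apply: vector_field_ext => //.
- by rewrite V1 W1 DE EB.
- by rewrite V2 W2 DE EB.
- by rewrite V3 W3 DE EB.
Qed.
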